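(* Let $R$ be a commutative noetherian ring, let $B$ and $C$ be semidualizing $R$-modules, and let $M$ and $N$ be $R$-modules. If $M\in\mathcal{B}_B(R)\cap\mathcal{A}_C(R)$ and $N\in\mathcal{B}_C(R)\cap\mathcal{A}_B(R)$, then one has $$\operatorname{Tor}^{\mathcal{F}_B\mathcal{M}}_i(M,N)\cong\operatorname{Tor}^{\mathcal{M}\mathcal{F}_C}_i(M,N)\quad\text{for all } i\geq 0.$$
   Context: $R$ is a commutative noetherian ring. A finitely generated $R$-module $C$ is semidualizing if the homothety map $R\to\operatorname{Hom}_R(C,C)$ is an isomorphism and $\operatorname{Ext}^i_R(C,C)=0$ for all $i\geq 1$. For a semidualizing module $C$, $\mathcal{F}_C(R)$ is the class of $R$-modules isomorphic to $F\otimes_R C$ with $F$ flat; it is precovering. A proper $\mathcal{F}_C$-resolution of an $R$-module $M$ is a complex $G=(\cdots\to G_1\to G_0\to 0)$ with each $G_i\in\mathcal{F}_C(R)$ together with an augmentation $G_0\to M$ such that $G^+=(\cdots\to G_1\to G_0\to M\to 0)$ is a complex (not necessarily exact) and $\operatorname{Hom}_R(Y,G^+)$ is exact for all $Y\in\mathcal{F}_C(R)$. Given such $G$ and an $R$-module $N$, for $i\geq 0$ set $$\operatorname{Tor}^{\mathcal{F}_C\mathcal{M}}_i(M,N):=H_i(G\otimes_R N),\qquad \operatorname{Tor}^{\mathcal{M}\mathcal{F}_C}_i(N,M):=H_i(N\otimes_R G),$$ so $\operatorname{Tor}^{\mathcal{M}\mathcal{F}_C}$ is computed by resolving the second argument.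 These are independent of choices. The Auslander class $\mathcal{A}_C(R)$ is the class of $R$-modules $M$ such that $\operatorname{Tor}^R_i(C,M)=0=\operatorname{Ext}^i_R(C,C\otimes_R M)$ for all $i\geq 1$ and the natural map $M\to\operatorname{Hom}_R(C,C\otimes_R M)$ is an isomorphism. The Bass class $\mathcal{B}_C(R)$ is the class of $R$-modules $M$ such that $\operatorname{Ext}^i_R(C,M)=0=\operatorname{Tor}^R_i(C,\operatorname{Hom}_R(C,M))$ for all $i\geq 1$ and the natural evaluation map $C\otimes_R\operatorname{Hom}_R(C,M)\to M$ is an isomorphism. The same definitions apply with $B$ in place of $C$. *)

(* Defs.v *)
From HB Require Import structures.
From mathcomp Require Import all_boot all_algebra.
From mathcomp Require Import boolp classical_sets functions cardinality fsbigop.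

Set Implicit Arguments.
Unset Strict Implicit.
Unset Printing Implicit Defensive.

Import GRing.Theory.

Local Open Scope classical_set_scope.
Local Open Scope ring_scope.
Local Open Scope quotient_scope.

Definition isomorphic (R : pzRingType) (U V : lmodType R) : Prop :=
  exists f : {linear U -> V}, bijective f.

Notation "U ≅ V" := (isomorphic U V) (at level 70, no associativity).

Definition trivial_module (R : pzRingType) (U : lmodType R) : Prop :=
  forall x : U, x = 0.

Definition submodule (R : pzRingType) (U : lmodType R) (S : set U) : Prop :=
  S 0 /\ forall (a : R) (x y : U), S x -> S y -> S (a *: x + y).

Definition submod_span (R : pzRingType) (U : lmodType R) (S : set U) :
    {pred U} :=
  fun u => `[< forall T : set U, submodule T -> S `<=` T -> T u >].

Section Span.
Variables (R : pzRingType) (U : lmodType R) (S : set U).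

Lemma span_closed : submod_closed (submod_span S).
Proof.
split=> [|a x y /asboolP Sx /asboolP Sy]; apply/asboolP => T Tm ST.
  by case: Tm.
by case: (Tm) => _; apply; [apply: Sx | apply: Sy].
Qed.

HB.instance Definition _ :=
  GRing.isSubmodClosed.Build R U (submod_span S) span_closed.

Lemma mem_span u : S u -> u \in submod_span S.
Proof. by move=> Su; apply/asboolP => T _; apply. Qed.

Definition quot_module : Type := @Quotient.quot U (submod_span S).

HB.instance Definition _ := GRing.Zmodule.on quot_module.

Definition quot_pi (u : U) : quot_module :=
  \pi_(@Quotient.quot U (submod_span S)) u.
Definition quot_repr (q : quot_module) : U :=
  repr (q : @Quotient.quot U (submod_span S)).

Lemma quot_reprK q : quot_pi (quot_repr q) = q.
Proof. exact: reprK. Qed.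

Lemma quot_piE u v : quot_pi u = quot_pi v <-> u - v \in submod_span S.
Proof.
by rewrite Quotient.idealrBE; split=> [uv|/eqP]; first exact/eqP.
Qed.

Lemma quot_pi_zmod : zmod_morphism quot_pi.
Proof.
move=> u v; rewrite /quot_pi.
by rewrite (Quotient.pi_add (submod_span S) u (- v))
  (Quotient.pi_opp (submod_span S) v).
Qed.

Let scaleq a q := quot_pi (a *: quot_repr q).

Let scaleqE a u : scaleq a (quot_pi u) = quot_pi (a *: u).
Proof.
by apply/quot_piE; rewrite -scalerBr rpredZ //; apply/quot_piE/quot_reprK.
Qed.

HB.instance Definition _ :=
  GRing.isZmodMorphism.Build U quot_module quot_pi quot_pi_zmod.

Let scaleqA a b q : scaleq a (scaleq b q) = scaleq (a * b) q.
Proof. by rewrite -[q]quot_reprK !scaleqE scalerA. Qed.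
Let scaleq1 : left_id 1 scaleq.
Proof. by move=> q; rewrite -[q]quot_reprK scaleqE scale1r. Qed.
Let scaleqDr : right_distributive scaleq +%R.
Proof.
move=> a p q; rewrite -[p]quot_reprK -[q]quot_reprK -raddfD !scaleqE.
by rewrite scalerDr raddfD.
Qed.
Let scaleqDl q : {morph scaleq^~ q : a b / a + b}.
Proof. by move=> a b; rewrite -[q]quot_reprK !scaleqE scalerDl raddfD. Qed.

HB.instance Definition _ := GRing.Zmodule_isLmodule.Build R quot_module
  scaleqA scaleq1 scaleqDr scaleqDl.

Lemma quot_piZ : scalable quot_pi.
Proof. by move=> a u; rewrite -scaleqE. Qed.

HB.instance Definition _ :=
  GRing.isScalable.Build R U quot_module *:%R quot_pi quot_piZ.

Variables (V : lmodType R) (f : {linear U -> V}).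
Hypothesis fS : forall u, S u -> f u = 0.

Lemma span_ker u : u \in submod_span S -> f u = 0.
Proof.
move=> /asboolP/(_ [set v | f v = 0]); apply=> //.
split=> [|a x y /= fx fy]; first exact: linear0.
by rewrite linearP fx fy scaler0 addr0.
Qed.

Definition quot_lift of (forall u, S u -> f u = 0) :=
  fun q : quot_module => f (quot_repr q).

Lemma quot_liftE u : quot_lift fS (quot_pi u) = f u.
Proof.
by apply/subr0_eq; rewrite -linearB; apply/span_ker/quot_piE/quot_reprK.
Qed.

Lemma quot_lift_linear : linear (quot_lift fS).
Proof.
move=> a p q; rewrite -[p]quot_reprK -[q]quot_reprK -linearP !quot_liftE.
exact: linearP.
Qed.

HB.instance Definition _ :=
  GRing.isLinear.Build R quot_module V *:%R (quot_lift fS) quot_lift_linear.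

End Span.

Section Kernel.
Variables (R : pzRingType) (U V : lmodType R) (f : {linear U -> V}).

Definition in_ker : {pred U} := fun u => f u == 0.

Lemma in_ker_closed : submod_closed in_ker.
Proof.
split=> [|a x y /eqP fx /eqP fy]; apply/eqP; first exact: linear0.
by rewrite linearP fx fy scaler0 addr0.
Qed.

HB.instance Definition _ :=
  GRing.isSubmodClosed.Build R U in_ker in_ker_closed.

Record ker_module := KerModule { ker_val :> U; ker_valP : ker_val \in in_ker }.

HB.instance Definition _ := [isSub for ker_val].
HB.instance Definition _ := [Choice of ker_module by <:].
HB.instance Definition _ := [SubChoice_isSubLmodule of ker_module by <:].

Definition ker_incl : {linear ker_module -> U} := (\val : ker_module -> U).

End Kernel.

Section Free.
Variables (R : pzRingType) (K : choiceType).

Definition fin_supp : {pred K -> R^o} :=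
  fun f => `[< finite_set [set x | f x != 0] >].

Lemma fin_supp_closed : submod_closed fin_supp.
Proof.
split=> [|a f g /asboolP ff /asboolP fg]; apply/asboolP.
  by apply: (sub_finite_set _ (finite_set0 K)) => x /=; rewrite eqxx.
have fU : finite_set ([set x | f x != 0] `|` [set x | g x != 0]).
  by rewrite finite_setU.
apply: sub_finite_set fU => x /=; apply: contra_neqP => /not_orP[].
move=> /negP/negPn/eqP fx /negP/negPn/eqP gx.
have -> : (a *: f + g) x = a *: f x + g x by [].
by rewrite fx gx scaler0 addr0.
Qed.

HB.instance Definition _ :=
  GRing.isSubmodClosed.Build R (K -> R^o) fin_supp fin_supp_closed.

Record free_module := FreeModule {
  free_coef :> K -> R^o;
  free_coefP : free_coef \in fin_supp
}.

HB.instance Definition _ := [isSub for free_coef].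
HB.instance Definition _ := [Choice of free_module by <:].
HB.instance Definition _ := [SubChoice_isSubLmodule of free_module by <:].

Lemma delta_fin_supp (x : K) : (fun y => (y == x)%:R : R^o) \in fin_supp.
Proof.
apply/asboolP; apply: (sub_finite_set _ (finite_set1 x)) => y /=.
by have [|_ /eqP] := eqVneq y x.
Qed.

Definition free_delta (x : K) : free_module := FreeModule (delta_fin_supp x).

Variables (V : lmodType R) (g : K -> V).

Definition free_lift (f : free_module) : V :=
  \sum_(x \in [set: K]) (f x : R) *: g x.

Lemma free_lift_seq (f : free_module) (s : seq K) :
  uniq s -> (forall x, f x != 0 -> x \in s) ->
  free_lift f = \sum_(x <- s) (f x : R) *: g x.
Proof.
move=> us fs; rewrite /free_lift (fsbigE s) //; last first.
  by move=> x _ xs; have [->|/fs/negPn] := eqVneq (f x) 0; rewrite ?scale0r ?xs.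
by apply: eq_bigl => x; rewrite in_setT.
Qed.

Lemma free_suppP (f : free_module) :
  exists2 s : seq K, uniq s & forall x, f x != 0 -> x \in s.
Proof.
have /asboolP/finite_seqP[s Es] := free_coefP f; exists (undup s) => [|x fx].
  exact: undup_uniq.
by have : [set x | f x != 0] x by []; rewrite mem_undup Es.
Qed.

Lemma free_lift_linear : linear free_lift.
Proof.
move=> a f h; have [s1 u1 f1] := free_suppP f; have [s2 u2 f2] := free_suppP h.
have us := undup_uniq (s1 ++ s2).
have s1s x : x \in s1 -> x \in undup (s1 ++ s2).
  by rewrite mem_undup mem_cat => ->.
have s2s x : x \in s2 -> x \in undup (s1 ++ s2).
  by rewrite mem_undup mem_cat orbC => ->.
rewrite !(free_lift_seq us) => [|x /f2/s2s|x /f1/s1s|x] //; last first.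
  have -> : (a *: f + h) x = a * f x + h x by [].
  have [fx|/f1/s1s//] := eqVneq (f x) 0; have [hx|/f2/s2s//] := eqVneq (h x) 0.
  by rewrite fx hx mulr0 addr0 eqxx.
rewrite scaler_sumr -big_split; apply: eq_bigr => x _ /=.
by rewrite scalerA; apply: (scalerDl (g x) (a * f x) (h x)).
Qed.

HB.instance Definition _ :=
  GRing.isLinear.Build R free_module V *:%R free_lift free_lift_linear.

Lemma free_lift_delta x : free_lift (free_delta x) = g x.
Proof.
rewrite (@free_lift_seq _ [:: x]) ?big_seq1 //= ?eqxx ?scale1r // => y.
by rewrite inE; case: (y == x) => //; rewrite eqxx.
Qed.

End Free.

Section Tensor.
Variables (R : comPzRingType) (M N : lmodType R).

Inductive tensor_rel : set (free_module R (M * N)%type) :=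
| Tensor_left a m m' n : tensor_rel
    (free_delta R (a *: m + m', n) -
      (a *: free_delta R (m, n) + free_delta R (m', n)))
| Tensor_right a m n n' : tensor_rel
    (free_delta R (m, a *: n + n') -
      (a *: free_delta R (m, n) + free_delta R (m, n'))).

Definition tensor : lmodType R := quot_module tensor_rel.

Definition pure (m : M) (n : N) : tensor :=
  quot_pi tensor_rel (free_delta R (m, n)).

Lemma pure_linearl n : linear (pure^~ n).
Proof.
move=> a m m'; rewrite /pure -linearP; apply/quot_piE/mem_span.
exact: Tensor_left.
Qed.

Lemma pure_linearr m : linear (pure m).
Proof.
move=> a n n'; rewrite /pure -linearP; apply/quot_piE/mem_span.
exact: Tensor_right.
Qed.

Lemma pure0l n : pure 0 n = 0.
Proof.
by have := pure_linearl n (-1) 0 0; rewrite scaler0 addr0 scaleN1r addNr.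
Qed.

Lemma pure0r m : pure m 0 = 0.
Proof.
by have := pure_linearr m (-1) 0 0; rewrite scaler0 addr0 scaleN1r addNr.
Qed.

Definition bilinear_map (P : lmodType R) (b : M -> N -> P) : Prop :=
  (forall n, linear (b^~ n)) /\ (forall m, linear (b m)).

Section Lift.
Variables (P : lmodType R) (b : M -> N -> P) (bP : bilinear_map b).

Lemma tensor_lift_rel u :
  tensor_rel u -> free_lift (fun x : M * N => b x.1 x.2) u = 0.
Proof.
by case=> [a m m' n|a m n n']; rewrite linearB linearP /= !free_lift_delta /=
  ?(bP.1 n a) ?(bP.2 m a) subrr.
Qed.

Definition tensor_lift : {linear tensor -> P} := quot_lift tensor_lift_rel.

Lemma tensor_lift_pure m n : tensor_lift (pure m n) = b m n.
Proof. exact: etrans (quot_liftE _ _) (free_lift_delta _ _). Qed.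

End Lift.

Lemma free_ext (K : choiceType) (P : lmodType R)
    (f g : {linear free_module R K -> P}) :
  (forall x, f (free_delta R x) = g (free_delta R x)) -> f =1 g.
Proof.
move=> fg u; have [s us su] := free_suppP u.
have -> : u = \sum_(x <- s) u x *: free_delta R x.
  apply/val_inj/funext => y; rewrite raddf_sum fct_sumE /=.
  have [ys|/su ys] := eqVneq (u y) 0; last first.
    rewrite (bigD1_seq y) //= [X in X + _](_ : _ = u y) ?big1 ?addr0 //.
      by move=> x xy; rewrite fctE /= eq_sym (negPf xy) scaler0.
    by rewrite fctE /= eqxx [LHS]mulr1.
  rewrite big1 // => x _; rewrite fctE /=.
  by have [<-|_] := eqVneq y x; rewrite ?ys ?scale0r ?scaler0.
by rewrite !linear_sum; apply: eq_bigr => x _; rewrite !linearZ fg.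
Qed.

Lemma tensor_ext (P : lmodType R) (f g : {linear tensor -> P}) :
  (forall m n, f (pure m n) = g (pure m n)) -> f =1 g.
Proof.
move=> fg u; rewrite -[u]quot_reprK.
apply: (@free_ext _ _ (f \o quot_pi tensor_rel) (g \o quot_pi tensor_rel)).
by case=> m n; apply: fg.
Qed.

End Tensor.

Notation "M ⊗ N" := (tensor M N) (at level 40, left associativity).

Section TensorMap.
Variables (R : comPzRingType) (M M' N N' : lmodType R).
Variables (f : {linear M -> M'}) (g : {linear N -> N'}).

Lemma tensor_map_bilinear : bilinear_map (fun m n => pure (f m) (g n)).
Proof.
split=> [n a m m'|m a n n']; rewrite linearP; first exact: pure_linearl.
exact: pure_linearr.
Qed.

Definition tensor_map : {linear M ⊗ N -> M' ⊗ N'} :=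
  tensor_lift tensor_map_bilinear.

Lemma tensor_map_pure m n : tensor_map (pure m n) = pure (f m) (g n).
Proof. exact: tensor_lift_pure. Qed.

End TensorMap.

Section Hom.
Variables (R : comPzRingType) (M N : lmodType R).

Definition hom_module : Type := {linear M -> N}.

HB.instance Definition _ := gen_eqMixin hom_module.
HB.instance Definition _ := gen_choiceMixin hom_module.

Lemma homP (f g : hom_module) : (forall x, f x = g x) -> f = g.
Proof.
case: f g => [f [[f1] [f2]]] [g [[g1] [g2]]] /= /funext fg.
case: g / fg g1 g2 => g1 g2.
by rewrite (Prop_irrelevance f1 g1) (Prop_irrelevance f2 g2).
Qed.

Lemma hom_scale_linear (a : R) (f : hom_module) : linear (fun x => a *: f x).
Proof. by move=> b x y; rewrite linearP scalerDr !scalerA mulrC. Qed.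

Definition hom0 : hom_module := \0.
Definition hom_add (f g : hom_module) : hom_module := f \+ g.
Definition hom_opp (f : hom_module) : hom_module := \- f.
Definition hom_scale (a : R) (f : hom_module) : hom_module :=
  HB.pack (fun x => a *: f x)
    (GRing.isLinear.Build R M N *:%R _ (hom_scale_linear a f)).

Let hom_addA : associative hom_add.
Proof. by move=> f g h; apply/homP => x /=; rewrite addrA. Qed.
Let hom_addC : commutative hom_add.
Proof. by move=> f g; apply/homP => x /=; rewrite addrC. Qed.
Let hom_add0 : left_id hom0 hom_add.
Proof. by move=> f; apply/homP => x /=; rewrite add0r. Qed.
Let hom_addN : left_inverse hom0 hom_opp hom_add.
Proof. by move=> f; apply/homP => x /=; rewrite addNr. Qed.

HB.instance Definition _ :=
  GRing.isZmodule.Build hom_module hom_addA hom_addC hom_add0 hom_addN.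

Let hom_scaleA a b f : hom_scale a (hom_scale b f) = hom_scale (a * b) f.
Proof. by apply/homP => x /=; rewrite scalerA. Qed.
Let hom_scale1 : left_id 1 hom_scale.
Proof. by move=> f; apply/homP => x /=; rewrite scale1r. Qed.
Let hom_scaleDr : right_distributive hom_scale +%R.
Proof. by move=> a f g; apply/homP => x /=; rewrite scalerDr. Qed.
Let hom_scaleDl f : {morph hom_scale^~ f : a b / a + b}.
Proof. by move=> a b; apply/homP => x /=; rewrite scalerDl. Qed.

HB.instance Definition _ := GRing.Zmodule_isLmodule.Build R hom_module
  hom_scaleA hom_scale1 hom_scaleDr hom_scaleDl.

End Hom.

Section HomMap.
Variables (R : comPzRingType) (M M' N N' : lmodType R).
Variables (f : {linear M' -> M}) (g : {linear N -> N'}).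

Definition hom_map_fun (h : hom_module M N) : hom_module M' N' := g \o h \o f.

Lemma hom_map_linear : linear hom_map_fun.
Proof. by move=> a h k; apply/homP => x /=; rewrite linearP. Qed.

HB.instance Definition _ :=
  GRing.isLinear.Build R (hom_module M N) (hom_module M' N') *:%R
    hom_map_fun hom_map_linear.

Definition hom_map : {linear hom_module M N -> hom_module M' N'} := hom_map_fun.

End HomMap.

Section CanonicalMaps.
Variables (R : comPzRingType) (C M : lmodType R).

Definition homothety_fun (r : R^o) : hom_module C C :=
  (r : R) *: (idfun : hom_module C C).

Lemma homothety_linear : linear homothety_fun.
Proof.
by move=> a r s; rewrite /homothety_fun scalerA -scalerDl.
Qed.

HB.instance Definition _ := GRing.isLinear.Build R R^o (hom_module C C) *:%R
  homothety_fun homothety_linear.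

Definition homothety : {linear R^o -> hom_module C C} := homothety_fun.

Definition unit_fun (m : M) : hom_module C (C ⊗ M) :=
  HB.pack (fun c => pure c m)
    (GRing.isLinear.Build R C (C ⊗ M) *:%R _ (pure_linearl m)).

Lemma unit_linear : linear unit_fun.
Proof. by move=> a m m'; apply/homP => c /=; apply: pure_linearr. Qed.

HB.instance Definition _ := GRing.isLinear.Build R M (hom_module C (C ⊗ M)) *:%R
  unit_fun unit_linear.

Definition tensor_unit : {linear M -> hom_module C (C ⊗ M)} := unit_fun.

Lemma eval_bilinear : bilinear_map (fun (c : C) (h : hom_module C M) => h c).
Proof. by split=> [h a c c'|c a h h'] //=; rewrite linearP. Qed.

Definition tensor_eval : {linear C ⊗ hom_module C M -> M} :=
  tensor_lift eval_bilinear.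

End CanonicalMaps.

Record chain_complex (R : pzRingType) := ChainComplex {
  chain_obj :> nat -> lmodType R;
  chain_diff : forall n, {linear chain_obj n.+1 -> chain_obj n};
  chain_diffK : forall n x, chain_diff n (chain_diff n.+1 x) = 0
}.

Definition chain_diff_out (R : pzRingType) (X : chain_complex R) (n : nat) :
    {linear X n -> X n.-1} :=
  match n with 0 => \0 | n.+1 => chain_diff X n end.

Definition middle_homology (R : pzRingType) (U V W : lmodType R)
    (f : {linear U -> V}) (g : {linear V -> W}) : lmodType R :=
  quot_module [set x : ker_module g | exists y, f y = ker_incl g x].

Definition homology (R : pzRingType) (X : chain_complex R) (n : nat) :
    lmodType R :=
  middle_homology (chain_diff X n) (chain_diff_out X n).

Definition exact_complex (R : pzRingType) (X : chain_complex R) : Prop :=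
  forall n (x : X n), chain_diff_out X n x = 0 -> exists y, chain_diff X n y = x.

Section Augment.
Variables (R : pzRingType) (X : chain_complex R) (M : lmodType R).
Variables (e : {linear X 0 -> M}) (eK : forall x, e (chain_diff X 0 x) = 0).

(* [M] sits in degree 0, so that [X n] is shifted to degree [n.+1]. *)
Definition augment_obj (n : nat) : lmodType R :=
  match n with 0 => M | n.+1 => X n end.

Definition augment_diff n : {linear augment_obj n.+1 -> augment_obj n} :=
  match n with 0 => e | n.+1 => chain_diff X n end.

Lemma augment_diff2 n x : augment_diff n (augment_diff n.+1 x) = 0.
Proof. by case: n x => [|n] x; [apply: eK | apply: chain_diffK]. Qed.

Definition augment : chain_complex R := ChainComplex augment_diff2.

End Augment.

Section ComplexFunctors.
Variables (R : comPzRingType) (X : chain_complex R) (Y : lmodType R).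

Lemma hom_diff2 n (x : hom_module Y (X n.+2)) :
  hom_map idfun (chain_diff X n) (hom_map idfun (chain_diff X n.+1) x) = 0.
Proof. by apply/homP => y /=; apply: chain_diffK. Qed.

Definition hom_complex : chain_complex R := ChainComplex hom_diff2.

Lemma tensor_diff2 n (x : X n.+2 ⊗ Y) :
  tensor_map (chain_diff X n) idfun (tensor_map (chain_diff X n.+1) idfun x) = 0.
Proof.
apply: (tensor_ext (f := tensor_map (chain_diff X n) idfun \o
  tensor_map (chain_diff X n.+1) idfun) (g := \0)) => a y.
have /= -> := tensor_map_pure (chain_diff X n.+1) idfun a y.
have /= -> := tensor_map_pure (chain_diff X n) idfun (chain_diff X n.+1 a) y.
by rewrite chain_diffK pure0l.
Qed.

Definition tensor_complex : chain_complex R := ChainComplex tensor_diff2.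

Lemma tensorl_diff2 n (x : Y ⊗ X n.+2) :
  tensor_map idfun (chain_diff X n) (tensor_map idfun (chain_diff X n.+1) x) = 0.
Proof.
apply: (tensor_ext (f := tensor_map idfun (chain_diff X n) \o
  tensor_map idfun (chain_diff X n.+1)) (g := \0)) => y a.
have /= -> := tensor_map_pure idfun (chain_diff X n.+1) y a.
have /= -> := tensor_map_pure idfun (chain_diff X n) y (chain_diff X n.+1 a).
by rewrite chain_diffK pure0r.
Qed.

Definition tensorl_complex : chain_complex R := ChainComplex tensorl_diff2.

End ComplexFunctors.

(* Ext and Tor are computed from one fixed free resolution [F] of the first
   argument: [F n] is free on the elements of the [n]-th syzygy. *)
Section FreeResolution.
Variables (R : comPzRingType) (M : lmodType R).

Definition free_cover (U : lmodType R) : {linear free_module R U -> U} :=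
  free_lift id.

Fixpoint syzygy (n : nat) : lmodType R :=
  match n with 0 => M | n.+1 => ker_module (free_cover (syzygy n)) end.

Definition free_res_diff n :
    {linear free_module R (syzygy n.+1) -> free_module R (syzygy n)} :=
  ker_incl (free_cover (syzygy n)) \o free_cover (syzygy n.+1).

Lemma free_res_diff2 n x : free_res_diff n (free_res_diff n.+1 x) = 0.
Proof.
have /eqP fx := ker_valP (free_cover (syzygy n.+2) x).
by apply: (etrans (congr1 (ker_incl _) fx)); apply: linear0.
Qed.

Definition free_resolution : chain_complex R := ChainComplex free_res_diff2.

Definition free_augment : {linear free_resolution 0 -> M} := free_cover M.

Lemma free_augmentK x : free_augment (chain_diff free_resolution 0 x) = 0.
Proof. exact/eqP/(ker_valP (free_cover (syzygy 1) x)). Qed.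

Lemma free_resolution_exact : exact_complex (augment free_augmentK).
Proof.
have cover_onto (U : lmodType R) (u : U) : exists x, free_cover U x = u.
  by exists (free_delta R u); apply: free_lift_delta.
case=> [|n] x xK; first exact: cover_onto.
have {}xK : x \in in_ker (free_cover (syzygy n)).
  by apply/eqP; case: n x xK => [|n] x xK //; apply: val_inj.
by have [y yK] := cover_onto _ (KerModule xK); exists y; rewrite /= yK.
Qed.

End FreeResolution.

Section ExtTor.
Variables (R : comPzRingType) (M N : lmodType R).

Definition Tor (i : nat) : lmodType R :=
  homology (tensor_complex (free_resolution M) N) i.

Definition Ext_diff i :
    {linear hom_module (free_resolution M i) N ->
            hom_module (free_resolution M i.+1) N} :=
  hom_map (chain_diff (free_resolution M) i) idfun.

Definition Ext_diff_in i :
    {linear hom_module (free_resolution M i.-1) N ->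
            hom_module (free_resolution M i) N} :=
  match i with 0 => \0 | i.+1 => Ext_diff i end.

Definition Ext (i : nat) : lmodType R :=
  middle_homology (Ext_diff_in i) (Ext_diff i).

End ExtTor.

Definition finitely_generated (R : pzRingType) (U : lmodType R)
    (S : set U) : Prop :=
  exists s : seq U, forall u, S u <-> u \in submod_span [set` s].

Definition noetherian (R : comPzRingType) : Prop :=
  forall I : set R^o, submodule I -> finitely_generated I.

Section Semidualizing.
Variable R : comPzRingType.
Implicit Types B C F M N Y : lmodType R.

Definition flat F : Prop :=
  forall (U V : lmodType R) (f : {linear U -> V}),
    injective f -> injective (tensor_map (idfun : {linear F -> F}) f).

Record semidualizing C : Prop := Semidualizing {
  semidualizing_fg : finitely_generated [set: C];
  semidualizing_homothety : bijective (homothety C);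
  semidualizing_Ext : forall i, (1 <= i)%N -> trivial_module (Ext C C i)
}.

Record auslander_class C M : Prop := AuslanderClass {
  auslander_Tor : forall i, (1 <= i)%N -> trivial_module (Tor C M i);
  auslander_Ext : forall i, (1 <= i)%N -> trivial_module (Ext C (C ⊗ M) i);
  auslander_unit : bijective (tensor_unit C M)
}.

Record bass_class C M : Prop := BassClass {
  bass_Ext : forall i, (1 <= i)%N -> trivial_module (Ext C M i);
  bass_Tor : forall i, (1 <= i)%N -> trivial_module (Tor C (hom_module C M) i);
  bass_eval : bijective (tensor_eval C M)
}.

Definition FC_class C Y : Prop :=
  exists2 F : lmodType R, flat F & Y ≅ F ⊗ C.

Record proper_FC_resolution C M := ProperFCResolution {
  res_complex : chain_complex R;
  res_aug : {linear res_complex 0 -> M};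
  res_augK : forall x, res_aug (chain_diff res_complex 0 x) = 0;
  res_FC : forall n, FC_class C (res_complex n);
  res_proper : forall Y, FC_class C Y ->
    exact_complex (hom_complex (augment res_augK) Y)
}.

(* Tor^{F_C M}_i(M, N), computed from a proper F_C-resolution of [M]. *)
Definition Tor_FM C M (G : proper_FC_resolution C M) N (i : nat) : lmodType R :=
  homology (tensor_complex (res_complex G) N) i.

(* Tor^{M F_C}_i(M, N), computed from a proper F_C-resolution of [N]. *)
Definition Tor_MF C M N (G : proper_FC_resolution C N) (i : nat) : lmodType R :=
  homology (tensorl_complex (res_complex G) M) i.

End Semidualizing.

(* Main.v *)
Require Import Defs.
From HB Require Import structures.
From mathcomp Require Import all_boot all_algebra.
From mathcomp Require Import boolp classical_sets functions.

Set Implicit Arguments.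
Unset Strict Implicit.
Unset Printing Implicit Defensive.

Import GRing.Theory.

(**
Both sides are isomorphic to the absolute [Tor M N i].

Let [G] be a proper F_B-resolution of a module [M] in the Bass class of [B].
Each term of [G] is [F ⊗ B] with [F] flat.  Over a noetherian ring [B] is
finitely presented, so flat base change of the isomorphism between [R] and
Hom(B, B) identifies [F] with Hom(B, F ⊗ B); hence Hom(B, G) consists of flat
modules and evaluation gives back [G] as B ⊗ Hom(B, G) ([FC_hom_flat_eval]).
Since [B] itself lies in F_B, properness says that Hom(B, G) is a flat
resolution of Hom(B, M).  Its tensor product with [B] has homology
Tor_i(B, Hom(B, M)), which vanishes for positive i by the Bass condition, and
evaluation identifies it with [G] augmented to [M].  So [G] is an honest exact
resolution of [M] ([proper_resolution_exact]).

If moreover Tor_i(B, N) = 0 for positive i, as for [N] in the Auslander class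
of [B], then Tor_i(F ⊗ B, N) = 0 for [F] flat: the terms of [G] are acyclic
for [N].  Comparing [G] with the free resolution [Q] of [N] through the double
complex [G ⊗ Q] identifies the homology of [G ⊗ N] with that of [M ⊗ Q]
([Tor_FM_balanced]), which is [Tor M N i] by balancedness.  The situation of
[C], [N] and [M] is the mirror image, so a resolution [H] of [N] gives the same
value, up to the symmetry of the tensor product.  The two relative resolutions
cannot be compared through [G ⊗ H] directly, because Tor_i(B, C) need not
vanish; the free resolutions mediate.

Every comparison of resolutions, including the balancedness of Tor and its
computation from flat resolutions, is an instance of [tensor_balance], which
rests on [edge_homology_iso] for double complexes with exact rows and columns.
*)

Local Open Scope classical_set_scope.
Local Open Scope ring_scope.

(** * Linear bijections, spans and subquotients *)

Section LinearMaps.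
Variable R : pzRingType.
Implicit Types U V W : lmodType R.

Definition linear_of U V (f : U -> V) (f_lin : linear f) : {linear U -> V} :=
  HB.pack f (GRing.isLinear.Build R U V *:%R f f_lin).

Lemma linear_injective U V (f : {linear U -> V}) :
  (forall x, f x = 0 -> x = 0) -> injective f.
Proof. by move=> f0 x y fxy; apply/subr0_eq/f0; rewrite linearB fxy subrr. Qed.

Lemma inj_surj_bijective (T T' : Type) (f : T -> T') :
  injective f -> (forall y, exists x, f x = y) -> bijective f.
Proof.
move=> f_inj /choice[g gK]; exists g => // x.
by apply: f_inj; rewrite gK.
Qed.

Lemma bijective_linear_inverse U V (f : {linear U -> V}) :
  bijective f -> exists g : {linear V -> U}, cancel f g /\ cancel g f.
Proof.
case=> g fK gK; have g_lin : linear g.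
  by move=> a x y; rewrite -{1}[x]gK -{1}[y]gK -linearP fK.
by exists (linear_of g_lin).
Qed.

Lemma isomorphic_sym U V : U ≅ V -> V ≅ U.
Proof.
by case=> f /bijective_linear_inverse[g [fK gK]]; exists g, f.
Qed.

Lemma isomorphic_trans U V W : U ≅ V -> V ≅ W -> U ≅ W.
Proof.
by case=> f f_bij [g g_bij]; exists (g \o f); apply: bij_comp.
Qed.

Lemma mem_span_submodule U (S : set U) u :
  submodule S -> u \in submod_span S <-> S u.
Proof. by move=> Sm; split=> [/asboolP/(_ S)|/mem_span//]; apply. Qed.

Lemma quot_pi_eq0 U (S : set U) u :
  submodule S -> (quot_pi S : {linear U -> quot_module S}) u = 0 <-> S u.
Proof.
move=> Sm; rewrite -[X in _ = X](linear0 (quot_pi S)).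
split=> [/quot_piE|Su]; first by rewrite subr0 => /(mem_span_submodule _ Sm).
by apply/quot_piE; rewrite subr0; apply: mem_span.
Qed.

Lemma image_submodule U V (f : {linear U -> V}) :
  submodule [set y | exists x, f x = y].
Proof.
split=> [|a _ _ [x <-] [y <-]]; first by exists 0; rewrite linear0.
by exists (a *: x + y); rewrite linearP.
Qed.

Lemma kernel_submodule U V (f : {linear U -> V}) : submodule [set x | f x = 0].
Proof.
split=> [|a x y /= fx fy]; first exact: linear0.
by rewrite linearP fx fy scaler0 addr0.
Qed.

Lemma trivial_isomorphic U V : U ≅ V -> trivial_module U -> trivial_module V.
Proof.
by case=> f [g _ gK] U0 y; rewrite -[y]gK (U0 (g y)) linear0.
Qed.

End LinearMaps.

Section MiddleHomology.
Variables (R : pzRingType) (U V W : lmodType R).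
Variables (f : {linear U -> V}) (g : {linear V -> W}).

Definition cycle_class (v : V) (gv : g v = 0) : middle_homology f g :=
  quot_pi _ (KerModule (introT eqP gv : v \in in_ker g)).

Lemma cycle_class_eq0 v (gv : g v = 0) :
  cycle_class gv = 0 <-> exists u, f u = v.
Proof.
rewrite -[0](linear0 (quot_pi _)) /cycle_class; split=> [/quot_piE|fu].
  rewrite subr0 => /mem_span_submodule; apply.
  split=> [|a x y [u fu] [u' fu']]; first by exists 0; apply: linear0.
  by exists (a *: u + u'); rewrite linearP fu fu'.
by apply/quot_piE; rewrite subr0; apply: mem_span.
Qed.

Lemma cycle_class_onto (q : middle_homology f g) :
  exists v (gv : g v = 0), q = cycle_class gv.
Proof.
rewrite -[q]quot_reprK; case: (quot_repr q) => v gv.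
exists v, (eqP gv); congr (quot_pi _ _); exact: val_inj.
Qed.

Lemma middle_homology_trivialP :
  trivial_module (middle_homology f g) <->
  forall v, g v = 0 -> exists u, f u = v.
Proof.
split=> [H0 v gv|fg q]; first by apply/(cycle_class_eq0 gv)/H0.
by have [v [gv ->]] := cycle_class_onto q; apply/cycle_class_eq0/fg.
Qed.

End MiddleHomology.

Section MiddleHomologyIso.
Variables (R : pzRingType) (U V W U' V' W' : lmodType R).
Variables (f : {linear U -> V}) (g : {linear V -> W}).
Variables (f' : {linear U' -> V'}) (g' : {linear V' -> W'}).
Variable h : {linear V -> V'}.

Lemma middle_homology_iso :
    (forall v, g v = 0 -> g' (h v) = 0) ->
    (forall v', g' v' = 0 -> exists2 v, g v = 0 & h v = v') ->
    (forall v, g v = 0 ->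
      (exists u, f u = v) <-> (exists u', f' u' = h v)) ->
  middle_homology f g ≅ middle_homology f' g'.
Proof.
move=> hZ h_onto hB.
pose k (v : ker_module g) : middle_homology f' g' :=
  cycle_class f' (hZ _ (eqP (ker_valP v))).
have k_lin : linear k.
  move=> a v w; rewrite /k /cycle_class -linearP; congr (quot_pi _ _).
  by apply: val_inj; rewrite /= linearP.
pose K : {linear ker_module g -> middle_homology f' g'} := linear_of k_lin.
have KS (v : ker_module g) : (exists y, f y = ker_incl g v) -> K v = 0.
  move=> fv; apply/(cycle_class_eq0 f').
  by apply/(hB _ (eqP (ker_valP v))).
pose H : {linear middle_homology f g -> middle_homology f' g'} := quot_lift KS.
have HE v (gv : g v = 0) : H (cycle_class f gv) = cycle_class f' (hZ v gv).
  apply: etrans (quot_liftE KS _) _; congr (quot_pi _ _); exact: val_inj.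
exists H; apply: inj_surj_bijective => [|q'].
  apply: linear_injective => q; have [v [gv ->]] := cycle_class_onto q.
  by rewrite HE => /cycle_class_eq0/(hB _ gv)/(cycle_class_eq0 f gv).
have [v' [gv' ->]] := cycle_class_onto q'; have [v gv hv] := h_onto _ gv'.
exists (cycle_class f gv); rewrite HE.
by congr (quot_pi _ _); apply: val_inj.
Qed.

End MiddleHomologyIso.

(** Only the kernel of the outgoing map matters, so its target may change; this
absorbs the different conventions for the map leaving degree 0. *)
Lemma middle_homology_cycles (R : pzRingType) (U V W W' : lmodType R)
    (f : {linear U -> V}) (g : {linear V -> W}) (g' : {linear V -> W'}) :
  (forall v, g v = 0 <-> g' v = 0) ->
  middle_homology f g ≅ middle_homology f g'.
Proof.
move=> gg'; apply: (middle_homology_iso (h := idfun)) => [v /gg'|v /gg' gv|] //.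
by exists v.
Qed.

(** * Balancing the two edges of a double complex *)

Section PairMap.
Variables (R : pzRingType) (U V W : lmodType R).

Lemma pair_linear (f : {linear U -> V}) (g : {linear U -> W}) :
  linear (fun x => (f x, g x)).
Proof. by move=> a x y; rewrite !linearP. Qed.

Definition pair_map f g : {linear U -> (V * W)%type} :=
  linear_of (pair_linear f g).

Lemma copair_linear (f : {linear U -> W}) (g : {linear V -> W}) :
  linear (fun x : U * V => f x.1 + g x.2).
Proof.
move=> a x y /=.
by rewrite !linearP /= scalerDr -!addrA; congr (_ + _); rewrite addrCA.
Qed.

Definition copair_map f g : {linear (U * V)%type -> W} :=
  linear_of (copair_linear f g).

End PairMap.

Section DoubleComplex.
Variables (R : pzRingType) (E : nat -> nat -> lmodType R).
Variable dh : forall p q, {linear E p.+1 q -> E p q}.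
Variable dv : forall p q, {linear E p q.+1 -> E p q}.
Hypothesis dhK : forall q p x, dh p q (dh p.+1 q x) = 0.
Hypothesis dvK : forall p q x, dv p q (dv p q.+1 x) = 0.
Hypothesis dhv : forall p q x, dh p q (dv p.+1 q x) = dv p q (dh p q.+1 x).

Definition row q : chain_complex R := @ChainComplex R (E^~ q) (dh^~ q) (@dhK q).
Definition column p : chain_complex R := @ChainComplex R (E p) (dv p) (@dvK p).

Hypothesis row_exact : forall q, exact_complex (row q.+1).
Hypothesis column_exact : forall p, exact_complex (column p.+1).

(** The corners of a double complex in the sense of Bergman's salamander lemma:
[receptor p q] is the homology at [E p q] between the diagonal coming in and
the pair of maps going out, [donor p q] the one at [E p.+1 q.+1] between the
pair of maps coming in and the diagonal going out.  A donor and a neighbouring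
receptor are joined by one differential, and on the edges receptors are the
homology of the edge; this replaces the total complex. *)
Definition receptor p q : lmodType R :=
  middle_homology (dv p q \o dh p q.+1)
    (pair_map (chain_diff_out (row q) p) (chain_diff_out (column p) q)).

Definition donor p q : lmodType R :=
  middle_homology (copair_map (dh p.+1 q.+1) (dv p.+1 q.+1))
    (dv p q \o dh p q.+1).

Lemma row_out0 q p (x : E p.+1 q) : chain_diff_out (row q) p (dh p q x) = 0.
Proof. by case: p x => [|p] x //; apply: dhK. Qed.

Lemma column_out0 p q (x : E p q.+1) :
  chain_diff_out (column p) q (dv p q x) = 0.
Proof. by case: q x => [|q] x //; apply: dvK. Qed.

Lemma pair_eq0 (U V : lmodType R) (x : U) (y : V) :
  (x, y) = 0 <-> x = 0 /\ y = 0.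
Proof. by split=> [[]|[-> ->]]. Qed.

(** Exactness of the column at its two consecutive places gives surjectivity and
injectivity of the map induced by [dv]. *)
Lemma donor_receptor_v p q : donor p q ≅ receptor p.+1 q.
Proof.
apply: (middle_homology_iso (h := dv p.+1 q)) => [x dx|y|x dx].
- by apply/pair_eq0; split; [rewrite -[RHS]dx; apply: dhv|apply: column_out0].
- move=> /pair_eq0[dhy dvy]; have [x xy] := column_exact dvy.
  by exists x => //=; rewrite -dhv -[RHS]dhy -xy.
split=> [[[s r] /= <-]|[s /= xs]].
  by exists s; rewrite linearD [X in _ + X]dvK addr0.
have /column_exact[r rE] : chain_diff_out (column p.+1) q.+1
    (x - dh p.+1 q.+1 s) = 0.
  by rewrite /= linearB -xs subrr.
by exists (s, r) => /=; rewrite [dv _ _ _]rE addrC subrK.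
Qed.

Lemma donor_receptor_h p q : donor p q ≅ receptor p q.+1.
Proof.
apply: (middle_homology_iso (h := dh p q.+1)) => [x dx|y|x dx].
- by apply/pair_eq0; split; [apply: row_out0|].
- move=> /pair_eq0[dhy dvy]; have [x xy] := row_exact dhy.
  by exists x => //; rewrite -[RHS]dvy -xy.
split=> [[[s r] /= <-]|[r /= xr]].
  by exists r; rewrite linearD [X in X + _]dhK add0r dhv.
have /row_exact[s sE] : chain_diff_out (row q.+1) p.+1
    (x - dv p.+1 q.+1 r) = 0.
  by rewrite /= linearB dhv -xr subrr.
by exists (s, r) => /=; rewrite [dh _ _ _]sE subrK.
Qed.

Lemma receptor_shift p q : receptor p.+1 q ≅ receptor p q.+1.
Proof.
apply: isomorphic_trans (donor_receptor_h p q).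
exact/isomorphic_sym/donor_receptor_v.
Qed.

Lemma receptor_antidiagonal n p q : (p + q)%N = n ->
  receptor p q ≅ receptor 0 n.
Proof.
elim: p q => [|p IHp] q.
  by rewrite add0n => ->; exists idfun; exists id.
move=> pqn; apply: isomorphic_trans (receptor_shift p q) (IHp _ _).
by rewrite addnS.
Qed.

End DoubleComplex.

Section EdgeHomology.
Variables (R : pzRingType) (E : nat -> nat -> lmodType R).
Variable dh : forall p q, {linear E p.+1 q -> E p q}.
Variable dv : forall p q, {linear E p q.+1 -> E p q}.
Hypothesis dhK : forall q p x, dh p q (dh p.+1 q x) = 0.
Hypothesis dvK : forall p q x, dv p q (dv p q.+1 x) = 0.
Hypothesis dhv : forall p q x, dh p q (dv p.+1 q x) = dv p q (dh p q.+1 x).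

Hypothesis row_exact : forall q, exact_complex (row dhK q.+1).
Hypothesis column_exact : forall p, exact_complex (column dvK p.+1).

(** A boundary [dh y] in the bottom row is a diagonal boundary, because the
column above [y] ends in a surjection. *)
Lemma bottom_edge_homology n :
  receptor dhK dvK n.+1 0 ≅ middle_homology (dh n.+1 0) (dh n 0).
Proof.
apply: (middle_homology_iso (h := idfun)) => [x /pair_eq0[]|x dx|x dx] //.
  by exists x => //; apply/pair_eq0.
split=> [[y <-]|[y /= <-]]; first by exists (dv n.+2 0 y); apply: dhv.
have [z <-] := @column_exact n.+1 0 y (erefl _).
by exists z; rewrite /= dhv.
Qed.

Lemma left_edge_homology n :
  receptor dhK dvK 0 n.+1 ≅ middle_homology (dv 0 n.+1) (dv 0 n).
Proof.
apply: (middle_homology_iso (h := idfun)) => [x /pair_eq0[]|x dx|x dx] //.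
  by exists x => //; apply/pair_eq0.
split=> [[y <-]|[y /= <-]]; first by exists (dh 0 n.+2 y).
by have [z <-] := @row_exact n.+1 0 y (erefl _); exists z.
Qed.

(** The two edges of a double complex have the same homology as soon as all rows
but the bottom one and all columns but the left one are exact.  In degree 0
this uses the corner [E 0 0] only as the target of two maps, which may be zero;
with zero maps there both sides are cokernels. *)
Lemma edge_homology_iso n :
  middle_homology (dh n.+1 0) (dh n 0) ≅ middle_homology (dv 0 n.+1) (dv 0 n).
Proof.
apply: isomorphic_trans (isomorphic_sym (bottom_edge_homology n)) _.
apply: isomorphic_trans (left_edge_homology n).
exact: receptor_antidiagonal (addn0 _).
Qed.

End EdgeHomology.

(** * Exactness properties of the tensor product *)

Section TensorTools.
Variable R : comPzRingType.
Implicit Types U V W : lmodType R.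

(** The elements where a linear property holds form a submodule containing the
pure tensors, so the quotient by it is hit by the zero map alone. *)
Lemma tensor_ind U V (P : U ⊗ V -> Prop) :
    (forall u v, P (pure u v)) ->
    (forall a x y, P x -> P y -> P (a *: x + y)) ->
  forall x, P x.
Proof.
move=> P_pure P_lin x.
have Pm : submodule P by split=> //; rewrite -(pure0l U (0 : V)).
apply/(quot_pi_eq0 _ Pm).
apply: (tensor_ext (f := quot_pi P) (g := \0)) => u v.
exact/(quot_pi_eq0 _ Pm)/P_pure.
Qed.

Lemma pureZl U V a (u : U) (v : V) : pure (a *: u) v = a *: pure u v.
Proof. by have := pure_linearl v a u 0; rewrite pure0l !addr0. Qed.

Lemma pureZr U V a (u : U) (v : V) : pure u (a *: v) = a *: pure u v.
Proof. by have := pure_linearr u a v 0; rewrite pure0r !addr0. Qed.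

Lemma pureBr U V (u : U) (v v' : V) : pure u (v - v') = pure u v - pure u v'.
Proof. exact: (linearB (linear_of (pure_linearr u))). Qed.

Lemma tensor_map_id U V (f : {linear U -> U}) (g : {linear V -> V}) :
  f =1 id -> g =1 id -> tensor_map f g =1 id.
Proof.
move=> f_id g_id; elim/tensor_ind => [u v|a x y IHx IHy].
  by rewrite tensor_map_pure f_id g_id.
by rewrite linearP IHx IHy.
Qed.

(** With some of the maps identities, this is functoriality or the interchange of
maps acting on different factors. *)
Lemma tensor_map_square U U1 U2 U3 V V1 V2 V3
    (f : {linear U -> U1}) (f' : {linear U1 -> U3})
    (k : {linear U -> U2}) (k' : {linear U2 -> U3})
    (g : {linear V -> V1}) (g' : {linear V1 -> V3})
    (l : {linear V -> V2}) (l' : {linear V2 -> V3}) :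
    (forall u, f' (f u) = k' (k u)) -> (forall v, g' (g v) = l' (l v)) ->
  forall x, tensor_map f' g' (tensor_map f g x) =
            tensor_map k' l' (tensor_map k l x).
Proof.
move=> fk gl; elim/tensor_ind => [u v|a x y IHx IHy].
  by rewrite !tensor_map_pure fk gl.
by rewrite !linearP IHx IHy.
Qed.

Lemma tensor_map_can U U' V V'
    (f : {linear U -> U'}) (f' : {linear U' -> U})
    (g : {linear V -> V'}) (g' : {linear V' -> V}) :
  cancel f f' -> cancel g g' -> cancel (tensor_map f g) (tensor_map f' g').
Proof.
move=> fK gK x.
rewrite (@tensor_map_square _ _ _ _ _ _ _ _ _ _ idfun idfun _ _ idfun idfun) //.
by rewrite !tensor_map_id.
Qed.

Lemma tensor_map_bijective U U' V V'
    (f : {linear U -> U'}) (g : {linear V -> V'}) :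
  bijective f -> bijective g -> bijective (tensor_map f g).
Proof.
move=> /bijective_linear_inverse[f' [fK f'K]].
move=> /bijective_linear_inverse[g' [gK g'K]].
by exists (tensor_map f' g'); apply: tensor_map_can.
Qed.

Lemma swap_bilinear U V : bilinear_map (fun (u : U) (v : V) => pure v u).
Proof. by split=> [v|u]; [apply: pure_linearr|apply: pure_linearl]. Qed.

Definition tensor_swap U V : {linear U ⊗ V -> V ⊗ U} :=
  tensor_lift (swap_bilinear U V).

Lemma tensor_swap_pure U V (u : U) (v : V) :
  tensor_swap U V (pure u v) = pure v u.
Proof. exact: tensor_lift_pure. Qed.

Lemma tensor_swapK U V : cancel (tensor_swap U V) (tensor_swap V U).
Proof.
elim/tensor_ind => [u v|a x y IHx IHy]; first by rewrite !tensor_swap_pure.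
by rewrite !linearP IHx IHy.
Qed.

Lemma tensor_swap_bijective U V : bijective (tensor_swap U V).
Proof. by exists (tensor_swap V U); apply: tensor_swapK. Qed.

Lemma tensor_swap_map U U' V V'
    (f : {linear U -> U'}) (g : {linear V -> V'}) x :
  tensor_swap U' V' (tensor_map f g x) = tensor_map g f (tensor_swap U V x).
Proof.
elim/tensor_ind: x => [u v|a x y IHx IHy]; last by rewrite !linearP IHx IHy.
by rewrite !(tensor_map_pure, tensor_swap_pure).
Qed.

Section Associativity.
Variables U V W : lmodType R.

Lemma assoc_bilinear : bilinear_map (fun (u : U) (x : V ⊗ W) =>
  tensor_map (linear_of (pure_linearr (N := V) u)) (idfun : {linear W -> W}) x).
Proof.
split=> [x a u u'|u]; last exact: linearP.
elim/tensor_ind: x => [v w|b x y IHx IHy].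
  by rewrite !tensor_map_pure /= pure_linearl pure_linearl.
rewrite !linearP IHx IHy !scalerDr !scalerA mulrC -!addrA; congr (_ + _).
by rewrite addrCA.
Qed.

Definition tensor_assoc : {linear U ⊗ (V ⊗ W) -> (U ⊗ V) ⊗ W} :=
  tensor_lift assoc_bilinear.

Lemma tensor_assoc_pure u v w :
  tensor_assoc (pure u (pure v w)) = pure (pure u v) w.
Proof. by rewrite [LHS]tensor_lift_pure tensor_map_pure. Qed.

Lemma unassoc_bilinear : bilinear_map (fun (x : U ⊗ V) (w : W) =>
  tensor_map (idfun : {linear U -> U}) (linear_of (pure_linearl (M := V) w)) x).
Proof.
split=> [w|x a w w']; first exact: linearP.
elim/tensor_ind: x => [u v|b x y IHx IHy].
  by rewrite !tensor_map_pure /= pure_linearr pure_linearr.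
rewrite !linearP IHx IHy !scalerDr !scalerA mulrC -!addrA; congr (_ + _).
by rewrite addrCA.
Qed.

Definition tensor_unassoc : {linear (U ⊗ V) ⊗ W -> U ⊗ (V ⊗ W)} :=
  tensor_lift unassoc_bilinear.

Lemma tensor_unassoc_pure u v w :
  tensor_unassoc (pure (pure u v) w) = pure u (pure v w).
Proof. by rewrite [LHS]tensor_lift_pure tensor_map_pure. Qed.

Lemma tensor_assocK : cancel tensor_assoc tensor_unassoc.
Proof.
elim/tensor_ind => [u|a x y IHx IHy]; last by rewrite !linearP IHx IHy.
elim/tensor_ind => [v w|a x y IHx IHy].
  by rewrite tensor_assoc_pure tensor_unassoc_pure.
by rewrite pure_linearr !linearP IHx IHy.
Qed.

Lemma tensor_unassocK : cancel tensor_unassoc tensor_assoc.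
Proof.
elim/tensor_ind => [x w|a x y IHx IHy]; last by rewrite !linearP IHx IHy.
elim/tensor_ind: x => [u v|a x y IHx IHy].
  by rewrite tensor_unassoc_pure tensor_assoc_pure.
by rewrite (pure_linearl w) !linearP IHx IHy.
Qed.

End Associativity.

Lemma tensor_assoc_map U V W W' (f : {linear W -> W'}) x :
  tensor_assoc U V W' (tensor_map idfun (tensor_map idfun f) x) =
  tensor_map idfun f (tensor_assoc U V W x).
Proof.
elim/tensor_ind: x => [u x|a x y IHx IHy]; last by rewrite !linearP IHx IHy.
elim/tensor_ind: x => [v w|a x y IHx IHy].
  by rewrite !(tensor_map_pure, tensor_assoc_pure).
by rewrite pure_linearr !linearP IHx IHy.
Qed.

Lemma tensor_map_onto U V V' (f : {linear V -> V'}) :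
    (forall y, exists x, f x = y) ->
  forall z, exists x, tensor_map (idfun : {linear U -> U}) f x = z.
Proof.
move=> f_onto; elim/tensor_ind => [u v'|a _ _ [x <-] [y <-]].
  by have [v <-] := f_onto v'; exists (pure u v); rewrite [LHS]tensor_map_pure.
by exists (a *: x + y); rewrite linearP.
Qed.

(** A set-theoretic section [s] of [g] is linear up to the image of [f].  Hence
[u ⊗ w] goes to the class of [u ⊗ s w] defines a linear map from [U ⊗ W] to the
cokernel of [U ⊗ f], which is a left inverse of the map induced by [U ⊗ g]. *)
Lemma tensor_right_exact U V V' W (f : {linear V' -> V}) (g : {linear V -> W}) :
    (forall x, g x = 0 -> exists y, f y = x) ->
    (forall z, exists x, g x = z) ->
  forall x, tensor_map (idfun : {linear U -> U}) g x = 0 ->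
  exists y, tensor_map (idfun : {linear U -> U}) f y = x.
Proof.
move=> fg /choice[s sK] x.
pose I : set (U ⊗ V) := [set x | exists y, tensor_map idfun f y = x].
have Im : submodule I by exact: image_submodule.
pose p : {linear U ⊗ V -> quot_module I} := quot_pi I.
have pE y : p y = 0 <-> I y by exact: quot_pi_eq0.
(* Modulo the image, [u ⊗ v] depends on [v] only through [g v]. *)
have pureB u v v' : g v = g v' -> p (pure u v) = p (pure u v').
  move=> gvv'; apply: subr0_eq; rewrite -linearB -pureBr; apply/pE.
  have /fg[v1 <-] : g (v - v') = 0 by rewrite linearB gvv' subrr.
  by exists (pure u v1); rewrite tensor_map_pure.
have b_bil : bilinear_map (fun u w => p (pure u (s w))).
  split=> [w a u u'|u a w w']; first by rewrite pure_linearl linearP.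
  by rewrite -linearP -pure_linearr; apply: pureB; rewrite linearP !sK.
have LE y : tensor_lift b_bil (tensor_map idfun g y) = p y.
  elim/tensor_ind: y => [u v|a y z IHy IHz]; last by rewrite !linearP IHy IHz.
  by rewrite tensor_map_pure tensor_lift_pure; apply: pureB; rewrite sK.
by move=> gx; apply/pE; rewrite -LE gx linear0.
Qed.

(** Flatness is stated for injections only; [g] factors as the cokernel of [f]
followed by an injection [h], to which right exactness and flatness apply. *)
Lemma flat_exact F U V W (f : {linear U -> V}) (g : {linear V -> W}) :
    @flat R F -> (forall x, g (f x) = 0) ->
    (forall y, g y = 0 -> exists x, f x = y) ->
  forall y, tensor_map (idfun : {linear F -> F}) g y = 0 ->
  exists x, tensor_map (idfun : {linear F -> F}) f x = y.
Proof.
move=> flatF gf0 fg y gy.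
pose I : set V := [set y | exists x, f x = y].
have Im : submodule I by exact: image_submodule.
have gI v : I v -> g v = 0 by case=> u <-.
pose p : {linear V -> quot_module I} := quot_pi I.
pose h : {linear quot_module I -> W} := quot_lift gI.
have hp v : h (p v) = g v by exact: (quot_liftE gI).
have pE v : p v = 0 <-> I v by exact: quot_pi_eq0.
have h_inj : injective h.
  apply: linear_injective => q; rewrite -[q]quot_reprK => hq.
  by apply/pE/fg; rewrite -hp.
apply: (tensor_right_exact (fun v => iffLR (pE v))).
  by move=> q; exists (quot_repr q); apply: quot_reprK.
apply: (flatF _ _ _ h_inj); rewrite linear0 -[RHS]gy.
rewrite (@tensor_map_square _ _ _ _ _ _ _ _ _ _ idfun idfun _ _ idfun g) //.
by rewrite tensor_map_id.
Qed.

Lemma flat_isomorphic F F' : F ≅ F' -> @flat R F -> flat F'.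
Proof.
move=> /isomorphic_sym[j j_bij] flatF U V f f_inj.
have jU : bijective (tensor_map j (idfun : {linear U -> U})).
  by apply: tensor_map_bijective => //; exists id.
have jV : bijective (tensor_map j (idfun : {linear V -> V})).
  by apply: tensor_map_bijective => //; exists id.
have jf x : tensor_map j idfun (tensor_map idfun f x) =
    tensor_map idfun f (tensor_map j idfun x) by exact: tensor_map_square.
move=> x y fxy; apply: (bij_inj jU); apply: (flatF _ _ _ f_inj).
by rewrite -[LHS]jf -[RHS]jf fxy.
Qed.

Section RingUnit.
Variable U : lmodType R.

Lemma lunit_bilinear : bilinear_map (fun (r : R^o) (u : U) => (r : R) *: u).
Proof.
split=> [u a r s|r a u v]; first by rewrite scalerA -scalerDl.
by rewrite scalerDr !scalerA mulrC.
Qed.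

Definition tensor_lunit : {linear R^o ⊗ U -> U} := tensor_lift lunit_bilinear.

Lemma tensor_lunit_pure r u : tensor_lunit (pure r u) = (r : R) *: u.
Proof. exact: tensor_lift_pure. Qed.

Lemma tensor_lunitK : cancel tensor_lunit (pure (1 : R^o)).
Proof.
elim/tensor_ind => [r u|a x y IHx IHy].
  by rewrite tensor_lunit_pure pureZr -pureZl; congr pure; apply: mulr1.
by rewrite linearP pure_linearr IHx IHy.
Qed.

Lemma tensor_lunit_bijective : bijective tensor_lunit.
Proof.
exists (pure (1 : R^o)) => [|u]; first exact: tensor_lunitK.
by rewrite tensor_lunit_pure scale1r.
Qed.

End RingUnit.

Lemma flat_ring : flat R^o.
Proof.
move=> U V f f_inj x y fxy; apply: (bij_inj (tensor_lunit_bijective U)).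
apply: f_inj.
suff fE z : f (tensor_lunit U z) = tensor_lunit V (tensor_map idfun f z).
  by rewrite !fE fxy.
elim/tensor_ind: z => [r u|a z t IHz IHt]; last by rewrite !linearP IHz IHt.
by rewrite !(tensor_map_pure, tensor_lunit_pure) linearZ.
Qed.

Section FreeFlat.
Variable K : choiceType.

Lemma coordinate_bilinear U (k : K) :
  bilinear_map (fun (x : free_module R K) (u : U) => (x k : R) *: u).
Proof.
split=> [u a x y|x a u v]; last by rewrite scalerDr !scalerA mulrC.
by rewrite scalerA -scalerDl.
Qed.

Definition coordinate U (k : K) : {linear free_module R K ⊗ U -> U} :=
  tensor_lift (coordinate_bilinear U k).

Lemma coordinate_pure U k x u : coordinate U k (pure x u) = (x k : R) *: u.
Proof. exact: tensor_lift_pure. Qed.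

Lemma free_expand (x : free_module R K) (s : seq K) :
  uniq s -> (forall k, x k != 0 -> k \in s) ->
  x = \sum_(k <- s) (x k : R) *: free_delta R k.
Proof.
move=> us xs; have <- := free_lift_seq (@free_delta R K) us xs.
by apply: (free_ext (f := idfun) (g := free_lift (@free_delta R K))) => k;
  rewrite /= free_lift_delta.
Qed.

(** A tensor over a free module is determined by its coordinates.  The sequence
is only required to be large enough, so that two of them can be merged. *)
Lemma coordinate_expand U (x : free_module R K ⊗ U) :
  exists s : seq K, forall s', uniq s' -> {subset s <= s'} ->
  x = \sum_(k <- s') pure (free_delta R k) (coordinate U k x).
Proof.
elim/tensor_ind: x => [x u|a x y [s1 E1] [s2 E2]].
  have [s us xs] := free_suppP x; exists s => s' us' ss'.
  rewrite {1}(free_expand us' (fun k xk => ss' k (xs k xk))).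
  rewrite [LHS](linear_sum (linear_of (pure_linearl u))).
  apply: eq_bigr => k _.
  by rewrite coordinate_pure pureZr -pureZl.
exists (s1 ++ s2) => s' us' ss'.
rewrite {1}(E1 s') 1?{1}(E2 s') // => [|k ks|k ks]; last first.
- by apply: ss'; rewrite mem_cat ks.
- by apply: ss'; rewrite mem_cat ks orbT.
rewrite scaler_sumr -big_split; apply: eq_bigr => k _.
by rewrite linearP pure_linearr.
Qed.

(** If [f] is injective and kills [x] after tensoring, it kills the coordinates
of [x], which therefore vanish. *)
Lemma flat_free : flat (free_module R K).
Proof.
move=> U V f f_inj; apply: linear_injective => x fx.
have fc k : f (coordinate U k x) = coordinate V k (tensor_map idfun f x).
  elim/tensor_ind: (x) => [y u|a y z IHy IHz]; last by rewrite !linearP IHy IHz.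
  by rewrite !(tensor_map_pure, coordinate_pure) linearZ.
have [s] := coordinate_expand x; move=> /(_ (undup s)) ->.
- rewrite big1 // => k _; rewrite [coordinate _ _ _](_ : _ = 0) ?pure0r //.
  by apply: f_inj; rewrite fc fx !linear0.
- exact: undup_uniq.
- by move=> k; rewrite mem_undup.
Qed.

End FreeFlat.

End TensorTools.

(** * Finite presentation over a noetherian ring *)

Section FinitePresentation.
Variable R : comPzRingType.

Lemma span_min (U : lmodType R) (S T : set U) :
  submodule T -> (forall u, S u -> T u) -> forall u, u \in submod_span S -> T u.
Proof. by move=> Tm ST u /asboolP; apply. Qed.

Lemma span_submodule (U : lmodType R) (S : set U) :
  submodule [set u | u \in submod_span S].
Proof.
by split=> [|a x y Sx Sy] /=; [exact: rpred0|rewrite rpredD ?rpredZ].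
Qed.

(** Hilbert's induction on the number of coordinates that may be nonzero: the
values of the last one form an ideal; lifts of its generators, together with
generators of the submodule where this coordinate vanishes, generate. *)
Lemma submodule_of_power_fg n (S : set ('I_n -> R^o)) :
  noetherian R -> submodule S -> finitely_generated S.
Proof.
move=> noethR; suff fg k : forall S : set ('I_n -> R^o), submodule S ->
    (forall x, S x -> forall i : 'I_n, (k <= i)%N -> x i = 0) ->
    finitely_generated S.
  by move=> Sm; apply: (fg n) => // x _ i; rewrite leqNgt ltn_ord.
elim: k => [|k IHk] {}S Sm S0.
  exists [::] => u; split=> [Su|].
    rewrite (_ : u = 0) ?rpred0 //; apply/funext => i; exact: (S0 u).
  exact: (span_min Sm).
have [kn|nk] := ltnP k n; last first.
  apply: IHk => // x Sx i ki; have := ltn_ord i.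
  by rewrite ltnNge (leq_trans nk ki).
pose i0 := Ordinal kn.
have Im : submodule [set r : R^o | exists2 x, S x & x i0 = r].
  split=> [|a _ _ [x Sx <-] [y Sy <-]]; first by exists 0; case: Sm.
  by exists (a *: x + y) => //; apply: Sm.2.
have [r rP] := noethR _ Im.
have /choice[c cP] (q : R^o) : exists x : 'I_n -> R^o,
    (exists2 x, S x & x i0 = q) -> S x /\ x i0 = q.
  have [[x Sx xq]|no] := pselect (exists2 x, S x & x i0 = q).
    by exists x.
  by exists 0.
have rc q : q \in r -> S (c q) /\ c q i0 = q.
  by move=> qr; apply/cP/rP/mem_span.
have [s sP] : finitely_generated [set x | S x /\ x i0 = 0].
  apply: IHk => [|x [Sx xi0] i].
    split=> [|a x y [Sx x0] [Sy y0]]; first by split=> //; case: Sm.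
    split; first exact: Sm.2.
    by rewrite [LHS](_ : _ = a *: x i0 + y i0) // x0 y0 scaler0 addr0.
  rewrite leq_eqVlt => /orP[/eqP ki|]; last exact: S0.
  by rewrite (_ : i = i0) //; apply: val_inj.
exists (s ++ map c r) => u; split=> [Su|]; last first.
  apply: span_min => // v /=.
  rewrite mem_cat => /orP[vs|/mapP[q /rc[Sq _] ->] //].
  by have [] := (sP v).2 (mem_span (S := [set` s]) vs).
(* Correct [u] by a combination [v] of the lifts to kill its coordinate [i0]. *)
have [v vr vu] : exists2 v, v \in submod_span [set` map c r] & v i0 = u i0.
  have : u i0 \in submod_span [set` r] by apply/rP; exists u.
  move: (u i0); apply: span_min => [|q qr].
    split=> [|a _ _ [x rx <-] [y ry <-]]; first by exists 0; rewrite ?rpred0.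
    by exists (a *: x + y); rewrite ?rpredD ?rpredZ.
  exists (c q); last by case: (rc q qr).
  by apply: mem_span => /=; apply: map_f.
have sub_span (t : seq ('I_n -> R^o)) : {subset t <= s ++ map c r} ->
    forall w, w \in submod_span [set` t] ->
    w \in submod_span [set` s ++ map c r].
  move=> tsub; apply: span_min; first exact: span_submodule.
  by move=> w /tsub wt; apply: mem_span.
have Sv : S v.
  by apply: span_min vr => // w /mapP[q /rc[Sq _] ->].
rewrite -[u](subrK v); apply: rpredD; last first.
  by apply: sub_span vr => w wr; rewrite mem_cat wr orbT.
apply: (sub_span s) => [w ws|]; first by rewrite mem_cat ws.
apply/sP; split; last by rewrite [LHS](_ : _ = u i0 - v i0) // vu subrr.
by rewrite addrC -scaleN1r; apply: Sm.2.
Qed.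

Section Combination.
Variables (n : nat) (U : lmodType R) (b : 'I_n -> U).

Lemma combination_linear :
  linear (fun a : 'I_n -> R^o => \sum_i (a i : R) *: b i).
Proof.
move=> r x y; rewrite scaler_sumr -big_split; apply: eq_bigr => i _ /=.
by rewrite scalerA -scalerDl.
Qed.

Definition combination : {linear ('I_n -> R^o) -> U} :=
  linear_of combination_linear.

End Combination.

(** The rows of [A] generate the relations between the generators [b], so [A]
presents [B], which is expressed by the universal property of [B]. *)
Lemma finite_presentation (B : lmodType R) :
    noetherian R -> finitely_generated [set: B] ->
  exists n (b : 'I_n -> B) m (A : 'I_m -> 'I_n -> R),
    (forall x, exists a : 'I_n -> R^o, combination b a = x) /\
    (forall j, \sum_i A j i *: b i = 0) /\
    (forall (Y : lmodType R) (c : 'I_n -> Y),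
       (forall j, \sum_i A j i *: c i = 0) ->
       exists h : {linear B -> Y}, forall i, h (b i) = c i).
Proof.
move=> noethR [s sP]; pose b (i : 'I_(size s)) := s`_i.
have b_gen x : exists a, combination b a = x.
  have : x \in submod_span [set` s] by apply/sP.
  apply: (span_min (T := [set y | exists a, combination b a = y])).
    exact: image_submodule.
  move=> y /= ys; have iy : (index y s < size s)%N by rewrite index_mem.
  exists (fun i => (i == Ordinal iy)%:R); rewrite /= (bigD1 (Ordinal iy)) //=.
  rewrite eqxx scale1r /b /= nth_index // big1 ?addr0 // => i /negPf ->.
  by rewrite scale0r.
have [t tP] :=
  submodule_of_power_fg noethR (kernel_submodule (combination b)).
exists (size s), b, (size t), (fun j i => nth 0 t j i); split=> //; split.
  move=> j; have /= := (tP t`_j).2; apply; apply: mem_span => /=.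
  exact: mem_nth.
move=> Y c Ac.
(* A family killed by the generating relations is killed by all of them. *)
have cK a : combination b a = 0 -> combination c a = 0.
  move=> /tP; apply: (span_min (T := [set a | combination c a = 0])).
    exact: kernel_submodule.
  move=> x /= xt; have it : (index x t < size t)%N by rewrite index_mem.
  by have := Ac (Ordinal it); rewrite /= nth_index.
have [a aP] := choice b_gen.
(* Two ways of writing an element in terms of [b] differ by a relation. *)
have h_lin : linear (fun x => combination c (a x)).
  move=> r x y; rewrite -linearP; apply/subr0_eq; rewrite -linearB.
  by apply: cK; rewrite linearB linearP !aP subrr.
exists (linear_of h_lin) => i /=.
pose d : 'I_(size s) -> R^o := fun k => (k == i)%:R.
have combE (V : lmodType R) (v : 'I_(size s) -> V) : combination v d = v i.
  rewrite /= (bigD1 i) //= {1}/d eqxx scale1r big1 ?addr0 // => k /negPf ki.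
  by rewrite /d ki scale0r.
rewrite -[RHS]combE; apply/subr0_eq; rewrite -[LHS](linearB (combination c)).
by apply: cK; rewrite linearB aP combE subrr.
Qed.

End FinitePresentation.

(** * Flat base change of a semidualizing module *)

Section Power.
Variables (R : comPzRingType) (F : lmodType R) (n : nat).

Lemma coordinate_inclusion_linear (U : lmodType R) (i : 'I_n) :
  linear (fun (x : U) (k : 'I_n) => if k == i then x else 0).
Proof.
move=> a x y; apply/funext => k.
rewrite [RHS](_ : _ = a *: (if k == i then x else 0) +
  if k == i then y else 0) //.
by case: ifP => //; rewrite scaler0 addr0.
Qed.

Definition coordinate_inclusion (U : lmodType R) i :
  {linear U -> ('I_n -> U)} :=
  linear_of (@coordinate_inclusion_linear U i).

Lemma coordinate_inclusion_sum (U : lmodType R) (x : 'I_n -> U) :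
  \sum_i coordinate_inclusion U i (x i) = x.
Proof.
apply/funext => k; rewrite fct_sumE /= (bigD1 k) //= eqxx big1 ?addr0 // => i.
by rewrite eq_sym => /negPf ->.
Qed.

Variable U : lmodType R.

Lemma power_bilinear : bilinear_map
  (fun (f : F) (x : 'I_n -> U) => (fun i => pure f (x i)) : 'I_n -> F ⊗ U).
Proof.
by split=> [x a f g|f a x y]; apply/funext => i;
  [apply: pure_linearl|apply: pure_linearr].
Qed.

(** Tensor products commute with finite powers. *)
Definition tensor_power : {linear F ⊗ ('I_n -> U) -> ('I_n -> F ⊗ U)} :=
  tensor_lift power_bilinear.

Lemma tensor_power_pure f x i : tensor_power (pure f x) i = pure f (x i).
Proof. by rewrite [tensor_power _]tensor_lift_pure. Qed.

Definition untensor_power (y : 'I_n -> F ⊗ U) : F ⊗ ('I_n -> U) :=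
  \sum_i tensor_map (idfun : {linear F -> F}) (coordinate_inclusion U i) (y i).

Lemma tensor_powerK : cancel tensor_power untensor_power.
Proof.
elim/tensor_ind => [f x|a x y IHx IHy].
  rewrite -{2}[x]coordinate_inclusion_sum.
  rewrite [RHS](linear_sum (linear_of (pure_linearr f))); apply: eq_bigr => i _.
  by rewrite tensor_power_pure tensor_map_pure.
rewrite -{2}IHx -{2}IHy scaler_sumr -big_split; apply: eq_bigr => i _.
rewrite linearP.
exact: (linearP (tensor_map idfun (coordinate_inclusion U i))).
Qed.

Lemma untensor_powerK : cancel untensor_power tensor_power.
Proof.
move=> y; rewrite linear_sum -[RHS]coordinate_inclusion_sum.
apply: eq_bigr => i _; elim/tensor_ind: (y i) => [f x|a x z IHx IHz].
  apply/funext => k; rewrite tensor_map_pure tensor_power_pure /=.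
  by case: ifP => // _; rewrite pure0r.
by rewrite !linearP IHx IHz.
Qed.

End Power.

Section FlatUnit.
Variable R : comPzRingType.

Lemma flat_unit_linear (F B : lmodType R) :
  linear (fun f : F => linear_of (pure_linearr f) : hom_module B (F ⊗ B)).
Proof. by move=> a f g; apply/homP => x; apply: pure_linearl. Qed.

Definition flat_unit (F B : lmodType R) :
  {linear F -> hom_module B (F ⊗ B)} :=
  linear_of (@flat_unit_linear F B).

Lemma tensor_ring_pure (F : lmodType R) (z : F ⊗ R^o) :
  exists f, z = pure f (1 : R^o).
Proof.
exists (tensor_lunit F (tensor_swap F R^o z)).
rewrite -(tensor_swap_pure (1 : R^o)) tensor_lunitK.
by rewrite [RHS]tensor_swapK.
Qed.

Lemma pure_ring_inj (F : lmodType R) (f : F) : pure f (1 : R^o) = 0 -> f = 0.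
Proof.
move=> f0; rewrite -[f]scale1r -(tensor_lunit_pure (1 : R^o)).
by rewrite -tensor_swap_pure f0 !linear0.
Qed.

Lemma relation_map_linear n m (A : 'I_m -> 'I_n -> R) (U : lmodType R) :
  linear (fun (c : 'I_n -> U) (j : 'I_m) => \sum_i A j i *: c i).
Proof.
move=> a x y; apply/funext => j.
rewrite [RHS](_ : _ = a *: (\sum_i A j i *: x i) + \sum_i A j i *: y i) //.
rewrite scaler_sumr -big_split; apply: eq_bigr => i _.
by rewrite scalerDr !scalerA mulrC.
Qed.

Definition relation_map n m (A : 'I_m -> 'I_n -> R) (U : lmodType R) :
  {linear ('I_n -> U) -> ('I_m -> U)} :=
  linear_of (@relation_map_linear n m A U).

Lemma multiples_map_linear n (U : lmodType R) (b : 'I_n -> U) :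
  linear (fun (r : R^o) (i : 'I_n) => (r : R) *: b i).
Proof.
move=> a x y; apply/funext => i; rewrite [LHS]scalerDl -scalerA; by [].
Qed.

Definition multiples_map n (U : lmodType R) (b : 'I_n -> U) :
  {linear R^o -> ('I_n -> U)} := linear_of (multiples_map_linear b).

(** With a presentation [A] of [B] on generators [b], a linear map from [B] to
[Y] is a family of vectors of [Y] killed by [A].  For [Y = B] the homothety
isomorphism turns this into the exact sequence
[0 -> R -> B^n -> B^m], with maps [phi] and [psi]; tensored with the flat [F]
it says that the families of [F ⊗ B] killed by [A] are exactly the
[f ⊗ b], each for a unique [f]. *)
Lemma flat_unit_bijective (F B : lmodType R) :
  noetherian R -> semidualizing B -> flat F -> bijective (flat_unit F B).
Proof.
move=> noethR [fgB homothety_bij _] flatF.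
have [n [b [m [A [b_gen [Ab lift]]]]]] := finite_presentation noethR fgB.
pose phi := multiples_map b; pose psi := relation_map A B.
have hom_ext (Y : lmodType R) (g h : {linear B -> Y}) :
    (forall i, g (b i) = h (b i)) -> g =1 h.
  move=> gh x; have [a <-] := b_gen x; rewrite /= !linear_sum.
  by apply: eq_bigr => i _; rewrite !linearZ gh.
have phi_inj : injective phi.
  apply: linear_injective => r rb; apply: (bij_inj homothety_bij).
  rewrite linear0; apply/homP; apply: hom_ext => i /=.
  exact: (congr1 (@^~ i) rb).
have psi_phi r : psi (phi r) = 0.
  apply/funext => j; rewrite -[RHS](scaler0 _ r) -(Ab j) scaler_sumr.
  by apply: eq_bigr => i _; rewrite !scalerA mulrC.
have phi_psi c : psi c = 0 -> exists r, phi r = c.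
  move=> psic; have [|h hP] := lift B c.
    by move=> j; apply: (congr1 (@^~ j) psic).
  case: homothety_bij => g _ gK; exists (g h); apply/funext => i.
  by rewrite -hP -[in RHS](gK h).
have phiE f i : tensor_power F n B (tensor_map idfun phi (pure f (1 : R^o))) i
    = pure f (b i).
  by rewrite tensor_map_pure tensor_power_pure /= scale1r.
apply: inj_surj_bijective => [|h].
  apply: linear_injective => f f0; apply: pure_ring_inj.
  apply: (flatF _ _ _ phi_inj); rewrite linear0.
  apply: (can_inj (@tensor_powerK _ F n B)); rewrite linear0.
  apply/funext => i; rewrite phiE.
  exact: (congr1 (fun g : hom_module B (F ⊗ B) => g (b i)) f0).
pose y : 'I_n -> F ⊗ B := fun i => h (b i).
have psiE z : tensor_power F m B (tensor_map idfun psi z) =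
    relation_map A (F ⊗ B) (tensor_power F n B z).
  elim/tensor_ind: z => [f c|a z t IHz IHt]; last by rewrite !linearP IHz IHt.
  apply/funext => j; rewrite tensor_map_pure tensor_power_pure.
  rewrite [LHS](linear_sum (linear_of (pure_linearr f))).
  by apply: eq_bigr => i _; rewrite tensor_power_pure [LHS]pureZr.
have [|z zy] := flat_exact flatF psi_phi phi_psi (y := untensor_power y).
  apply: (can_inj (@tensor_powerK _ F m B)); rewrite psiE linear0.
  rewrite untensor_powerK; apply/funext => j /=.
  by under eq_bigr => i _ do rewrite -linearZ; rewrite -linear_sum Ab linear0.
have [f zf] := tensor_ring_pure z; exists f; apply/homP; apply: hom_ext => i.
by rewrite -[RHS]/(y i) -[y]untensor_powerK -zy zf phiE.
Qed.

Lemma FC_class_self (B : lmodType R) : FC_class B B.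
Proof.
exists R^o; first exact: flat_ring.
apply: isomorphic_sym; exists (tensor_lunit B); exact: tensor_lunit_bijective.
Qed.

(** After replacing [Y] by [F ⊗ B] and Hom(B, F ⊗ B) by [F], the evaluation map
becomes the swap of the two factors. *)
Lemma FC_hom_flat_eval (B Y : lmodType R) :
    noetherian R -> semidualizing B -> FC_class B Y ->
  flat (hom_module B Y) /\ bijective (tensor_eval B Y).
Proof.
move=> noethR sdB [F flatF /isomorphic_sym[j j_bij]].
have u_bij := flat_unit_bijective noethR sdB flatF.
pose v : {linear F -> hom_module B Y} := hom_map idfun j \o flat_unit F B.
have v_bij : bijective v.
  apply: bij_comp u_bij; have [j' [jK j'K]] := bijective_linear_inverse j_bij.
  by exists (hom_map idfun j') => h; apply/homP => x /=; rewrite ?jK ?j'K.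
split; first by apply: flat_isomorphic flatF; exists v.
pose k := tensor_map (idfun : {linear B -> B}) v.
have k_bij : bijective k by apply: tensor_map_bijective => //; exists id.
have Ek x : tensor_eval B Y (k x) = j (tensor_swap B F x).
  elim/tensor_ind: x => [c f|a x y IHx IHy].
    by rewrite tensor_map_pure tensor_lift_pure tensor_swap_pure.
  by rewrite !linearP IHx IHy.
have jk_bij : bijective (j \o tensor_swap B F).
  by apply: bij_comp => //; apply: tensor_swap_bijective.
have [k' kK k'K] := k_bij.
apply: (eq_bij (bij_comp jk_bij (Bijective k'K kK))) => x.
by rewrite -[RHS](congr1 (tensor_eval B Y) (k'K x)); symmetry; apply: Ek.
Qed.

End FlatUnit.

(** * Complexes, their homology and acyclicity *)

Section Complexes.
Variable R : pzRingType.
Implicit Types X Y : chain_complex R.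

Definition shift_complex X : chain_complex R :=
  @ChainComplex R (fun n => X n.+1) (fun n => chain_diff X n.+1)
    (fun n => @chain_diffK R X n.+1).

Section ComplexMap.
Variables (X Y : chain_complex R) (h : forall n, {linear X n -> Y n}).
Hypothesis h_diff :
  forall n x, chain_diff Y n (h n.+1 x) = h n (chain_diff X n x).
Hypothesis h_bij : forall n, bijective (h n).

Lemma complex_map_out n x :
  chain_diff_out Y n (h n x) = h n.-1 (chain_diff_out X n x).
Proof. by case: n x => [|n] x; [rewrite linear0|apply: h_diff]. Qed.

Lemma exact_complex_iso : exact_complex X -> exact_complex Y.
Proof.
move=> exX n y; have [g gK hK] := h_bij n; rewrite -[y]hK complex_map_out => dy.
have /exX[x <-] : chain_diff_out X n (g y) = 0.
  by apply: (bij_inj (h_bij n.-1)); rewrite dy linear0.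
by exists (h n.+1 x); apply: h_diff.
Qed.

Lemma homology_iso n : homology X n ≅ homology Y n.
Proof.
have [g gK hK] := h_bij n.
apply: (middle_homology_iso (h := h n)) => [x dx|y|x dx].
- by rewrite complex_map_out dx linear0.
- rewrite -[y]hK complex_map_out => dy; exists (g y) => //.
  by apply: (bij_inj (h_bij n.-1)); rewrite dy linear0.
split=> [[u <-]|[y dy]]; first by exists (h n.+1 u); apply: h_diff.
have [g' g'K hK'] := h_bij n.+1; exists (g' y).
by apply: (bij_inj (h_bij n)); rewrite -h_diff hK'.
Qed.

End ComplexMap.
End Complexes.

Section Balance.
Variable R : comPzRingType.
Implicit Types (X Y : chain_complex R) (A F U V : lmodType R).

Lemma tensor_complex_swap_exact X U :
  exact_complex (tensorl_complex X U) -> exact_complex (tensor_complex X U).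
Proof.
apply: (exact_complex_iso (X := tensorl_complex X U) (Y := tensor_complex X U)
  (h := fun n => tensor_swap U (X n))) => n; last first.
  exact: tensor_swap_bijective.
by move=> x; apply/esym/tensor_swap_map.
Qed.

Lemma tensor_complex_swap_homology X U n :
  homology (tensorl_complex X U) n ≅ homology (tensor_complex X U) n.
Proof.
apply: (homology_iso (X := tensorl_complex X U) (Y := tensor_complex X U)
  (h := fun n => tensor_swap U (X n))) => {}n; last first.
  exact: tensor_swap_bijective.
by move=> x; apply/esym/tensor_swap_map.
Qed.

Lemma tensorl_assoc_exact X U V :
  exact_complex (tensorl_complex (tensorl_complex X V) U) ->
  exact_complex (tensorl_complex X (U ⊗ V)).
Proof.
apply: (exact_complex_iso (X := tensorl_complex (tensorl_complex X V) U)
  (Y := tensorl_complex X (U ⊗ V))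
  (h := fun n => tensor_assoc U V (X n))) => n.
  by move=> x; apply/esym/tensor_assoc_map.
exists (tensor_unassoc U V (X n)); first exact: tensor_assocK.
exact: tensor_unassocK.
Qed.

Lemma tensorl_isomorphic_exact X U V : U ≅ V ->
  exact_complex (tensorl_complex X U) -> exact_complex (tensorl_complex X V).
Proof.
case=> j j_bij; apply: (exact_complex_iso (X := tensorl_complex X U)
  (Y := tensorl_complex X V) (h := fun n => tensor_map j idfun)) => n.
  by move=> x; apply: tensor_map_square.
by apply: tensor_map_bijective => //; exists id.
Qed.

(** This is [edge_homology_iso] for the double complex [X ⊗ Y], where [X] and [Y]
are augmented: [X 0] and [Y 0] are the modules being resolved. *)
Lemma tensor_balance X Y n :
    (forall p, exact_complex (tensorl_complex Y (X p.+1))) ->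
    (forall q, exact_complex (tensor_complex X (Y q.+1))) ->
  homology (tensor_complex (shift_complex X) (Y 0)) n ≅
  homology (tensorl_complex (shift_complex Y) (X 0)) n.
Proof.
move=> exY exX.
(* The maps into the corner [X 0 ⊗ Y 0] are replaced by 0, so that the edges
   compute cokernels in degree 0. *)
pose E p q : lmodType R := X p ⊗ Y q.
pose dh p q : {linear E p.+1 q -> E p q} :=
  if (p + q == 0)%N then (\0 : {linear X p.+1 ⊗ Y q -> X p ⊗ Y q})
  else tensor_map (chain_diff X p) idfun.
pose dv p q : {linear E p q.+1 -> E p q} :=
  if (p + q == 0)%N then (\0 : {linear X p ⊗ Y q.+1 -> X p ⊗ Y q})
  else tensor_map idfun (chain_diff Y q).
have dhK q p x : dh p q (dh p.+1 q x) = 0.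
  rewrite /dh; case: ifP => // _.
  exact: (chain_diffK (c := tensor_complex X (Y q))).
have dvK p q x : dv p q (dv p q.+1 x) = 0.
  rewrite /dv addnS; case: ifP => // _.
  exact: (chain_diffK (c := tensorl_complex Y (X p))).
have dhv p q x : dh p q (dv p.+1 q x) = dv p q (dh p q.+1 x).
  rewrite /dh /dv addnS; case: ifP => // _; exact: tensor_map_square.
have rowE q : exact_complex (row dhK q.+1).
  case=> [|p] x xK; have [|y <-] := exX q _ x; rewrite ?[LHS]/= //.
  - by exists y; rewrite /= /dh.
  - by move: xK; rewrite /= /dh addnS.
  - by exists y; rewrite /= /dh.
have colE p : exact_complex (column dvK p.+1).
  case=> [|q] x xK; have [|y <-] := exY p _ x; rewrite ?[LHS]/= //.
  - by exists y.
  - by exists y.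
have edge_iso := edge_homology_iso dhv rowE colE n.
apply: isomorphic_trans (isomorphic_trans edge_iso _).
  by case: n {edge_iso} => [|n]; apply: middle_homology_cycles.
by case: n {edge_iso} => [|n]; apply: middle_homology_cycles.
Qed.

Lemma flat_tensorl_exact F Y :
  flat F -> exact_complex Y -> exact_complex (tensorl_complex Y F).
Proof.
move=> flatF exY [|n] x.
  move=> _; apply: tensor_map_onto => y; exact: (exY 0 y).
apply: flat_exact => // [y|y]; first exact: chain_diffK.
exact: (exY n.+1).
Qed.

Lemma tensorl_exact U Y :
    exact_complex Y ->
    (forall n, (1 <= n)%N ->
       trivial_module (homology (tensorl_complex (shift_complex Y) U) n)) ->
  exact_complex (tensorl_complex Y U).
Proof.
move=> exY H0 [|[|n]] x dx.
- apply: tensor_map_onto => y; exact: (exY 0 y).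
- apply: tensor_right_exact dx => [y|y]; [exact: (exY 1)|exact: (exY 0)].
by have /middle_homology_trivialP/(_ x) := H0 n.+1 isT; apply.
Qed.

(** The free resolution of [U] and the flat resolution [Y] balance, since both
consist of flat modules; so [Y] computes Tor through its second argument. *)
Lemma Tor_right U Y n :
    exact_complex Y -> (forall q, flat (Y q.+1)) ->
  Tor U (Y 0) n ≅ homology (tensorl_complex (shift_complex Y) U) n.
Proof.
move=> exY flatY.
have exX := @free_resolution_exact R U.
have := @tensor_balance (augment (@free_augmentK R U)) Y n.
rewrite (_ : homology (tensor_complex (shift_complex _) _) n =
  Tor U (Y 0) n); last by case: n.
apply=> [p|q].
  by apply: flat_tensorl_exact => //; apply: flat_free.
by apply: tensor_complex_swap_exact; apply: flat_tensorl_exact.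
Qed.

(** Homology in positive degrees is Tor; near the augmentation right exactness
of the tensor product is enough. *)
Lemma acyclic_tensorl_exact U Y :
    exact_complex Y -> (forall q, flat (Y q.+1)) ->
    (forall n, (1 <= n)%N -> trivial_module (Tor U (Y 0) n)) ->
  exact_complex (tensorl_complex Y U).
Proof.
move=> exY flatY Tor0; apply: tensorl_exact => // n n1.
exact: trivial_isomorphic (Tor_right U n exY flatY) (Tor0 n n1).
Qed.

End Balance.

Section RelativeTor.
Variable R : comPzRingType.
Implicit Types (B M N F : lmodType R).

Definition free_res_aug N := augment (@free_augmentK R N).

(** Tor_i(F ⊗ B, N) = F ⊗ Tor_i(B, N) for [F] flat, so modules in F_B are acyclic
for every [N] for which [B] is. *)
Lemma FC_tensorl_exact B N Y :
    (forall n, (1 <= n)%N -> trivial_module (Tor B N n)) -> FC_class B Y ->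
  exact_complex (tensorl_complex (free_res_aug N) Y).
Proof.
move=> Tor0 [F flatF /isomorphic_sym[j j_bij]].
have exB : exact_complex (tensorl_complex (free_res_aug N) B).
  apply: acyclic_tensorl_exact => //; first exact: free_resolution_exact.
  by move=> q; apply: flat_free.
apply: (tensorl_isomorphic_exact (ex_intro _ j j_bij)).
by apply: tensorl_assoc_exact; apply: flat_tensorl_exact.
Qed.

(** Hom(B, G) is a flat resolution of Hom(B, M), and tensoring it with [B] keeps it
exact by the Bass condition; evaluation identifies the result with [G]. *)
Lemma proper_resolution_exact B M (G : proper_FC_resolution B M) :
    noetherian R -> semidualizing B -> bass_class B M ->
  exact_complex (augment (@res_augK R B M G)).
Proof.
move=> noethR sdB [_ Tor0 evalM_bij].
pose L := hom_complex (augment (@res_augK R B M G)) B.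
have exL : exact_complex L by apply: res_proper; apply: FC_class_self.
have exBL : exact_complex (tensorl_complex L B).
  apply: acyclic_tensorl_exact => // q.
  by have [] := FC_hom_flat_eval noethR sdB (@res_FC R B M G q).
apply: (exact_complex_iso (X := tensorl_complex L B)
  (h := fun n => tensor_eval B (augment (@res_augK R B M G) n))) => // [n x|].
  elim/tensor_ind: x => [b g|a x y IHx IHy]; last by rewrite !linearP IHx IHy.
  have -> : chain_diff (tensorl_complex L B) n (pure b g) =
      pure b (chain_diff L n g).
    exact: tensor_map_pure.
  by rewrite !tensor_lift_pure.
case=> [|n]; first exact: evalM_bij.
by have [] := FC_hom_flat_eval noethR sdB (@res_FC R B M G n).
Qed.

(** The double complex formed by [G] and the free resolution of [N] has exact
columns because the terms of [G] are acyclic for [N], and exact rows because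
free modules are flat and [G] resolves [M]. *)
Lemma Tor_FM_balanced B M N (G : proper_FC_resolution B M) n :
    noetherian R -> semidualizing B -> bass_class B M ->
    (forall n, (1 <= n)%N -> trivial_module (Tor B N n)) ->
  Tor_FM G N n ≅ homology (tensorl_complex (free_resolution N) M) n.
Proof.
move=> noethR sdB bassM Tor0.
have exG := @proper_resolution_exact B M G noethR sdB bassM.
have bal := @tensor_balance R (augment (@res_augK R B M G)) (free_res_aug N) n.
apply: isomorphic_trans (isomorphic_trans (bal _ _) _).
- by case: n {bal} => [|n]; apply: middle_homology_cycles.
- by move=> p; apply: (FC_tensorl_exact Tor0); apply: res_FC.
- move=> q; apply: tensor_complex_swap_exact; apply: flat_tensorl_exact => //.
  exact: flat_free.
by case: n {bal} => [|n]; apply: middle_homology_cycles.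
Qed.

End RelativeTor.

Theorem proposition4p4 (R : comPzRingType) (noethR : noetherian R)
    (B C : lmodType R) (sdB : semidualizing B) (sdC : semidualizing C)
    (M N : lmodType R)
    (M_bassB : bass_class B M) (M_auslC : auslander_class C M)
    (N_bassC : bass_class C N) (N_auslB : auslander_class B N)
    (G : proper_FC_resolution B M) (H : proper_FC_resolution C N) (i : nat) :
  Tor_FM G N i ≅ Tor_MF M H i.
Proof.
apply: isomorphic_trans (Tor_FM_balanced G i noethR sdB M_bassB _) _.
  exact: auslander_Tor N_auslB.
have swap := tensor_complex_swap_homology (res_complex H) M i.
apply: isomorphic_trans _ (isomorphic_sym swap).
have TorH := Tor_FM_balanced H i noethR sdC N_bassC (auslander_Tor M_auslC).
apply: isomorphic_trans _ (isomorphic_sym TorH).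
apply: isomorphic_trans _ (isomorphic_sym (tensor_complex_swap_homology _ _ _)).
apply: isomorphic_sym.
apply: (Tor_right M i (@free_resolution_exact R N)) => q; exact: flat_free.
Qed.
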